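(* Let $n\in\mathbb{N}$ with $n+1$ odd, and let $a=(a_j)_{j\ge0}$ and $c=(c_j)_{j\ge0}$ be $(n+1)$-periodic infinite sequences of real numbers, with period words $a_0a_1a_2\cdots a_n$ and $c_0c_1c_2\cdots c_n$, respectively. Suppose that \[ c_0=a_1, \qquad |c_1+a_2|=|c_n+a_0|, \qquad |c_1-a_2|=|c_n-a_0|, \] and that \[ |c_j+a_{j+1}|=|c_{n-j+1}+a_{n-j+2}| \quad\text{and}\quad |c_j-a_{j+1}|=|c_{n-j+1}-a_{n-j+2}| \] for all $j=2,3,\dots,\frac n2$. Let $T(a,0,c)$ be the $(n+1)$-periodic tridiagonal operator on $\ell^2(\mathbb{N}_0)$ with zero main diagonal, subdiagonal $a$ and superdiagonal $c$. Then \[ \overline{W(T(a,0,c))}=\mathrm{conv}\left(W(B^+)\cup W(B^-)\right), \] where $B^+$ and $B^-$ are the $(\frac n2+1)\times(\frac n2+1)$ tridiagonal matrices \[ B^{\pm}=\begin{pmatrix} \pm a_1 & c_1 & 0 & \cdots & 0 & 0 & 0\\ a_2 & 0 & c_2 & \cdots & 0 & 0 & 0\\ 0 & a_3 & 0 & \cdots & 0 & 0 & 0\\ \vdots & \vdots & \vdots & \ddots & \vdots & \vdots & \vdots\\ 0 & 0 & 0 & \cdots & 0 & c_{\frac n2-1} & 0\\ 0 & 0 & 0 & \cdots & a_{\frac n2} & 0 & \sqrt2\, c_{\frac n2}\\ 0 & 0 & 0 & \cdots & 0 & \sqrt2\, a_{\frac n2+1} & 0 \end{pmatrix}. \] That is,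 with rows and columns indexed by $1,\dots,\frac n2+1$: the $(1,1)$ entry is $\pm a_1$ and all other diagonal entries are $0$; for $1\le j<\frac n2$ the $(j,j+1)$ entry is $c_j$ and the $(j+1,j)$ entry is $a_{j+1}$; the $(\frac n2,\frac n2+1)$ entry is $\sqrt2\,c_{n/2}$ and the $(\frac n2+1,\frac n2)$ entry is $\sqrt2\,a_{\frac n2+1}$; all other entries are $0$. (For $n=2$, $B^\pm=\begin{pmatrix}\pm a_1&\sqrt2\,c_1\\ \sqrt2\,a_2&0\end{pmatrix}$.)
   Context: $\mathbb{N}$ is the set of positive integers and $\mathbb{N}_0$ the set of nonnegative integers. A sequence $a$ is $(n+1)$-periodic if $a_{k+n+1}=a_k$ for all $k$; its period word is $a_0a_1\cdots a_n$. For $(n+1)$-periodic sequences $a,b,c$ indexed by $\mathbb{N}_0$, $T(a,b,c)$ is the bounded operator on $\ell^2(\mathbb{N}_0)$ whose matrix (rows and columns indexed by $\mathbb{N}_0$) has $(j,j)$ entry $b_j$, $(j,j+1)$ entry $c_j$, $(j+1,j)$ entry $a_{j+1}$ for all $j\ge 0$, and all other entries $0$. In $T(a,0,c)$ the diagonal sequence $b$ is identically zero. For a bounded operator $A$ on a Hilbert space, $W(A)=\{\langle Ax,x\rangle : \|x\|=1\}\subset\mathbb{C}$ is its numerical range; finite square matrices act on $\mathbb{C}^m$ with the standard inner product. $\mathrm{conv}$ denotes convex hull in $\mathbb{C}$ and the bar denotes closure. *)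

(* Defs.v *)
From HB Require Import structures.
From mathcomp Require Import all_boot all_order all_algebra.
From mathcomp Require Import complex.
From mathcomp Require Import all_classical all_reals all_analysis.

Set Implicit Arguments.
Unset Strict Implicit.
Unset Printing Implicit Defensive.

Import Order.TTheory GRing.Theory Num.Theory.
Import numFieldNormedType.Exports.

Local Open Scope classical_set_scope.
Local Open Scope ring_scope.

Definition seq_periodic (T : Type) (p : nat) (u : nat -> T) : Prop :=
  forall k, u (k + p)%N = u k.

Section ComplexNumericalRange.
Variable R : realType.

(* The alias [R[i]^o] is what carries the usual topology and the module
   structure of the field of complex numbers over itself. *)
Local Notation C := (R[i]^o).

Definition l2 : set (nat -> C) :=
  [set x | cvgn (series (fun k => `|x k| ^+ 2 : C))].

(* Inner products are linear in the first argument. *)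
Definition l2_dot (x y : nat -> C) : C :=
  limn (series (fun k => x k * Num.conj (y k) : C)).

(* [dotmx] is the standard inner product of row vectors. *)
Definition cV_dot (m : nat) (x y : 'cV[R[i]]_m) : C := dotmx x^T y^T.

(* Numerical range of [A] on the inner product space with carrier [H] and
   inner product [dot]; [dot x x = 1] says that [x] has norm 1. *)
Definition numerical_range (V : Type) (H : set V) (dot : V -> V -> C)
    (A : V -> V) : set C :=
  [set dot (A x) x | x in [set x | H x /\ dot x x = 1]].

Definition l2_numerical_range (A : (nat -> C) -> (nat -> C)) : set C :=
  numerical_range l2 l2_dot A.

Definition mx_numerical_range (m : nat) (A : 'M[R[i]]_m) : set C :=
  numerical_range setT (@cV_dot m) (mulmx A).

(* The weights of [convex_set] range over the elements [t] of [R[i]] such that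
   [0 <= t <= 1]; these are exactly the real numbers of the unit interval. *)
Definition convex_hull (A : set C) : set C := smallest (@convex_set R[i] C) A.

Definition tridiag_entry (a b c : nat -> C) (j k : nat) : C :=
  if k == j then b j
  else if k == j.+1 then c j
  else if j == k.+1 then a j
  else 0.

(* The entries of row [j] vanish from column [j + 2] on. *)
Definition tridiag_op (a b c : nat -> C) (x : nat -> C) : nat -> C :=
  fun j => \sum_(k < j.+2) tridiag_entry a b c j k * x k.

End ComplexNumericalRange.

(* The matrix B^+ (for s = 1) or B^- (for s = -1), with m = n/2. Rows and
   columns are numbered from 1 to m + 1 in the mathematics, hence p and q. *)
Definition B_mx (R : realType) (a c : nat -> R) (m : nat) (s : R) :
    'M[R]_m.+1 :=
  \matrix_(i, j)
    let p := (val i).+1 in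
    let q := (val j).+1 in
    if (p == 1%N) && (q == 1%N) then s * a 1%N
    else if q == p.+1 then (if p == m then Num.sqrt 2 * c p else c p)
    else if p == q.+1 then (if q == m then Num.sqrt 2 * a p else a p)
    else 0.

(* Main.v *)
(**
  Write [p k = c k + a (k+1)] and [d k = c k - a (k+1)]: the quadratic form of
  [T(a,0,c)] at [x] is the sum over the edges [{k, k+1}] of
  [p k * Re z + i * d k * Im z] with [z = x (k+1) * conj (x k)], and the
  hypotheses say that, up to signs, [p] and [d] are invariant under the
  reflection [k -> -k] of the edges modulo the period [n + 1 = 2 m + 1]. Folding
  along this reflection maps the sites to [0, ..., m]; if [U i] is the weight
  carried by fold site [i] (the fixed site [m] being counted twice), then by
  Cauchy-Schwarz the total edge weight [B i] satisfies [|B i|^2 <= U i U (i+1)].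
  The values obtained from all such [(U, B)] form a compact set, which thus
  contains the closure of [W(T)]. Its elements with equality everywhere are
  exactly the points of [W(B^+)] and [W(B^-)], because the phases of
  [v (i+1) * conj (v i)] can be prescribed along a path; replacing the disks
  [|B i|^2 <= U i U (i+1)] one at a time by the convex hull of their boundary
  circles shows that the set lies in the convex hull of these points.
  Conversely, every such point is a limit of values of [T] at long truncations
  of a vector of periodic modulus, and the values at finitely supported vectors
  form a convex set, because [T] is invariant under shifts by the period.
*)
Require Import Defs.
From mathcomp Require Import all_boot all_order all_algebra.
From mathcomp Require Import complex.
From mathcomp Require Import all_classical all_reals all_analysis.
From mathcomp Require Import ring lra zify.

Set Implicit Arguments.
Unset Strict Implicit.
Unset Printing Implicit Defensive.

Import Order.TTheory GRing.Theory Num.Theory.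
Import numFieldNormedType.Exports.

Local Open Scope classical_set_scope.
Local Open Scope ring_scope.
Local Open Scope complex_scope.

Local Notation Re := (@complex.Re _).
Local Notation Im := (@complex.Im _).

(* Otherwise [x ^*] would mean [conjc x] or [Num.conj x] depending on which of
   [complex_scope] and [ring_scope] is innermost. *)
Local Notation "x ^*" := (Num.conj x) : complex_scope.

(** * Limits of complex-valued functions *)

Section ComplexTopology.
Variable R : realType.
Local Notation C := (R[i]^o).
Implicit Types (x y : R) (z : R[i]).

Lemma eps_real (e : R[i]) : 0 < e -> exists2 r : R, 0 < r & e = r%:C.
Proof. by case: e => a b; rewrite ltcE /= => /andP[/eqP -> a0]; exists a. Qed.

Lemma cvg_real_complex (T : Type) (F : set_system T) {FF : Filter F}
    (f : T -> R) (a : R) :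
  f @ F --> a -> (fun t => (f t)%:C : C) @ F --> (a%:C : C).
Proof.
move=> /cvgrPdist_lt fa; apply/cvgrPdist_lt => _ /eps_real[r r0 ->].
near=> t; rewrite -rmorphB normc_def /= expr0n /= addr0 sqrtr_sqr ltcR.
by near: t; exact: fa.
Unshelve. all: by end_near. Qed.

Lemma cvg_Complex (T : Type) (F : set_system T) {FF : Filter F}
    (f g : T -> R) (a b : R) : f @ F --> a -> g @ F --> b ->
  (fun t => f t +i* g t : C) @ F --> (a +i* b : C).
Proof.
move=> fa gb.
have E x y : (x +i* y : C) = (x%:C : C) + (0 +i* 1 : C) * (y%:C : C).
  by rewrite [LHS]complexE.
rewrite E (_ : (fun t => _) = (fun t => ((f t)%:C : C) + (0 +i* 1 : C) * ((g t)%:C : C))).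
  by apply: cvgD; [|apply: cvgM; [exact: cvg_cst|]]; exact: cvg_real_complex.
by apply/funext => t; exact: E.
Qed.

Lemma Re_continuous : continuous (Re : C -> R).
Proof.
move=> z; apply/(cvgrPdist_lt (F := nbhs z) (FF := nbhs_filter z)) => e e0.
apply/nbhs_ballP; exists e%:C => [|t zt]; first by rewrite /= ltcR.
rewrite -ltcR; have <- : Re (z - t) = Re z - Re t by case: (z) (t) => ? ? [].
exact: le_lt_trans (normc_ge_Re (z - t)) zt.
Qed.

Lemma closure_cvg (A : set C) (u : nat -> C) (l : C) :
  (\forall n \near \oo, A (u n)) -> u @ \oo --> l -> closure A l.
Proof.
move=> uA ul B /ul uB.
by have [n [? ?]] := filter_ex (filterI uA uB); exists (u n).
Qed.

End ComplexTopology.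

(** * Sums over whole periods, paired by a reflection *)

Section PeriodSums.
Variable V : nmodType.
Implicit Types (f : nat -> V) (m M N : nat).

Lemma sum_blocks f N M :
  \sum_(k < M * N) f k = \sum_(t < M) \sum_(r < N) f (t * N + r)%N.
Proof.
elim: M => [|M IH]; first by rewrite !big_ord0.
rewrite big_ord_recr /= -IH mulSn addnC big_split_ord /=.
by congr (_ + _).
Qed.

Lemma sum_fold_even f m :
  \sum_(k < m.*2) f k = \sum_(i < m) (f i + f (m.*2.-1 - i)%N).
Proof.
rewrite -addnn big_split_ord /= big_split /=; congr (_ + _).
rewrite (reindex_inj rev_ord_inj) /=; apply: eq_bigr => i _.
by congr (f _); case: i => i /= ?; lia.
Qed.

(** The pairing of edges: modulo [m.*2.+1], negation fixes [0] and exchanges [i.+1] with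
    [m.*2 - i]. *)
Lemma sum_fold_first f m :
  \sum_(k < m.*2.+1) f k = f 0%N + \sum_(i < m) (f i.+1 + f (m.*2 - i)%N).
Proof.
rewrite big_ord_recl /= (sum_fold_even (fun k => f k.+1)); congr (_ + _).
by apply: eq_bigr => -[i im] _ /=; congr (_ + f _); lia.
Qed.

(** The pairing of sites, with site [r.+1] at index [r]; the fixed point is now [m]. *)
Lemma sum_fold_mid f m :
  \sum_(k < m.*2.+1) f k = f m + \sum_(i < m) (f i + f (m.*2 - i)%N).
Proof.
elim: m f => [|m IH] f; first by rewrite big_ord0 addr0 big_ord1.
rewrite doubleS big_ord_recr big_ord_recl /= (IH (fun k => f k.+1)) /=.
rewrite [in RHS]big_ord_recl /= subn0.
rewrite [f 0%N + (_ + _)]addrCA -addrA [in LHS]addrAC; congr (_ + (_ + _)).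
by apply: eq_bigr => -[i im] _ /=; rewrite /bump /=; congr (_ + f _); lia.
Qed.

End PeriodSums.

(** * Squared moduli and the quadratic form of an edge *)

Section EdgeForms.
Variable R : realType.
Implicit Types (w x y z : R[i]) (p d t : R).

Definition sqn z : R := Re z ^+ 2 + Im z ^+ 2.

(** An edge contributes [c z + a z^*], which is only real-linear in [z]; [p] and [d] are its
    coefficients on the two real coordinates ([edgeE]). *)
Definition edge p d z : R[i] := (p * Re z) +i* (d * Im z).

Lemma complex_ext z w : Re z = Re w -> Im z = Im w -> z = w.
Proof. by case: z w => ? ? [? ?] /= -> ->. Qed.

Lemma sqn_ge0 z : 0 <= sqn z.
Proof. by rewrite addr_ge0 ?sqr_ge0. Qed.

Lemma sqnM x y : sqn (x * y) = sqn x * sqn y.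
Proof. by case: x y => ? ? [? ?]; rewrite /sqn /=; ring. Qed.

Lemma sqnJ x : sqn x^* = sqn x.
Proof. by case: x => ? ?; rewrite /sqn /= sqrrN. Qed.

Lemma sqn_real t : sqn t%:C = t ^+ 2.
Proof. by rewrite /sqn /= expr0n addr0. Qed.

Lemma sqn0 : sqn 0 = 0.
Proof. by rewrite /sqn /= expr0n addr0. Qed.

Lemma sqn_normC z : (sqn z)%:C = `|z| ^+ 2.
Proof. exact: add_Re2_Im2. Qed.

Lemma mul_conjC z : z * z^* = (sqn z)%:C.
Proof. by case: z => ? ?; apply: complex_ext; rewrite /sqn /=; ring. Qed.

Lemma conjc_scale t z : (t%:C * z)^* = t%:C * z^*.
Proof. by rewrite rmorphM; congr (_ * _); exact: conjc_real. Qed.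

Lemma edgeD p d x y : edge p d (x + y) = edge p d x + edge p d y.
Proof. by case: x y => ? ? [? ?]; rewrite /edge /= !mulrDr. Qed.

Lemma edge0 p d : edge p d 0 = 0.
Proof. by rewrite /edge /= !mulr0. Qed.

Lemma edge_sum (I : Type) (r : seq I) p d (F : I -> R[i]) :
  edge p d (\sum_(i <- r) F i) = \sum_(i <- r) edge p d (F i).
Proof. exact: (big_morph _ (edgeD p d) (edge0 p d)). Qed.

Lemma edgeZ p d t z : edge p d (t%:C * z) = t%:C * edge p d z.
Proof. by case: z => ? ?; apply: complex_ext => /=; ring. Qed.

Lemma edgeE (c a : R) z : c%:C * z + a%:C * z^* = edge (c + a) (c - a) z.
Proof. by case: z => ? ?; apply: complex_ext => /=; ring. Qed.

(* The triples [(z, u, w)] with [0 <= u, w] and [|z|^2 <= u w] form a convex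
   cone; this is the Cauchy-Schwarz inequality. *)
Lemma cone_add (z z' : R[i]) (u w u' w' : R) :
  0 <= u -> 0 <= w -> 0 <= u' -> 0 <= w' ->
  sqn z <= u * w -> sqn z' <= u' * w' -> sqn (z + z') <= (u + u') * (w + w').
Proof.
case: z z' => x y [x' y']; rewrite /sqn /= => u0 w0 u'0 w'0 h h'.
pose s := x * x' + y * y'; pose v := u * w' + u' * w.
have v0 : 0 <= v by rewrite addr_ge0 ?mulr_ge0.
have sv : (2 * s) ^+ 2 <= v ^+ 2.
  have : s ^+ 2 <= (u * w) * (u' * w').
    apply: le_trans (ler_pM _ _ h h'); rewrite ?addr_ge0 ?sqr_ge0 //.
    rewrite /s; have := sqr_ge0 (x * y' - y * x'); lra.
  have := sqr_ge0 (u * w' - u' * w); rewrite /v; lra.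
have {}sv : 2 * s <= v.
  by rewrite (le_trans (ler_norm _)) // -(@ler_pXn2r _ 2) ?nnegrE ?real_normK ?num_real.
rewrite /s /v in sv; lra.
Qed.

Lemma cone_sum (I : Type) (r : seq I) (Z : I -> R[i]) (U W : I -> R) :
  (forall i, 0 <= U i) -> (forall i, 0 <= W i) ->
  (forall i, sqn (Z i) <= U i * W i) ->
  sqn (\sum_(i <- r) Z i) <= (\sum_(i <- r) U i) * (\sum_(i <- r) W i).
Proof.
move=> U0 W0 h.
suff [] : [/\ 0 <= \sum_(i <- r) U i, 0 <= \sum_(i <- r) W i &
  sqn (\sum_(i <- r) Z i) <= (\sum_(i <- r) U i) * (\sum_(i <- r) W i)] by [].
elim: r => [|i r [IU IW IZ]]; first by rewrite !big_nil sqn0 mulr0.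
by rewrite !big_cons; split; rewrite ?addr_ge0 //; exact: cone_add.
Qed.

Lemma edge_amgm (x y : R[i]) : `|2 * Re (x * y^*)| <= sqn x + sqn y.
Proof.
case: x y => x x' [y y']; rewrite /sqn /= ler_norml.
have := (sqr_ge0 (x - y), sqr_ge0 (x' - y')).
have := (sqr_ge0 (x + y), sqr_ge0 (x' + y')).
by move=> [? ?] [? ?]; apply/andP; split; lra.
Qed.

End EdgeForms.

(** * Folded values and their extremal points *)

Section Folding.
Variables (R : realType) (m : nat) (p d : nat -> R).
Local Notation N := (m.*2.+1).
Local Notation e k := (edge (p k) (d k)).

Definition edge_sum_at (x : nat -> R[i]) (k : nat) : R[i] :=
  e k (x k.+1 * (x k)^*).

(** Edge [0] is its own mirror image, and [d 0 = 0] will be assumed, so only the real part of its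
    product matters; [b] stands for twice that part. *)
Definition fold_value (b : R) (B : nat -> R[i]) : R[i] :=
  (p 0%N / 2 * b)%:C + \sum_(i < m) e i.+1 (B i).

Definition fold_weight (U : nat -> R) : R := \sum_(i < m) U i + U m / 2.

(* [U i] is the total weight of the two sites of each period that the
   reflection maps to fold site [i] (the site [m] is its own mirror image,
   hence counted twice), [B i] the total weight of the corresponding edges. *)
Definition folded (s : R) (z : R[i]) : Prop :=
  exists U b B, [/\ forall i, 0 <= U i, fold_weight U = s, `|b| <= U 0%N,
    forall i, (i < m)%N -> sqn (B i) <= U i * U i.+1 & z = fold_value b B].

Definition sign_to (u v : R) : R := if u == v then 1 else -1.

Lemma sign_toM u v : `|u| = `|v| -> u * sign_to u v = v.
Proof.
rewrite /sign_to => /eqP; rewrite eqr_norm2; case: eqVneq => [->|_] /=.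
  by rewrite mulr1.
by move=> /eqP ->; rewrite mulrN1 opprK.
Qed.

Lemma sign_toK u v : sign_to u v ^+ 2 = 1.
Proof. by rewrite /sign_to; case: ifP; rewrite ?sqrrN expr1n. Qed.

(** The symmetry hypotheses equate absolute values only; the sign changes are moved onto the edge
    product, whose modulus they preserve. *)
Definition mirror (i : nat) (z : R[i]) : R[i] :=
  (sign_to (p i.+1) (p (m.*2 - i)%N) * Re z) +i*
  (sign_to (d i.+1) (d (m.*2 - i)%N) * Im z).

Lemma sqn_mirror i z : sqn (mirror i z) = sqn z.
Proof. by rewrite /sqn /= !exprMn !sign_toK !mul1r. Qed.

Hypothesis m_gt0 : (0 < m)%N.
Hypothesis p_per : seq_periodic N p.
Hypothesis d_per : seq_periodic N d.
Hypothesis d0 : d 0%N = 0.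
Hypothesis p_sym : forall i, (i < m)%N -> `|p i.+1| = `|p (m.*2 - i)%N|.
Hypothesis d_sym : forall i, (i < m)%N -> `|d i.+1| = `|d (m.*2 - i)%N|.

Lemma edge_per t r : edge (p (t * N + r)%N) (d (t * N + r)%N) = e r.
Proof.
suff E (T : Type) (u : nat -> T) : seq_periodic N u -> u (t * N + r)%N = u r.
  by rewrite !E.
by move=> u_per; elim: t => [//|t IH]; rewrite mulSn -addnA addnC u_per.
Qed.

Lemma edge_mirror i z : (i < m)%N ->
  e (m.*2 - i)%N z = e i.+1 (mirror i z).
Proof.
move=> im; rewrite /edge /= -{1}(sign_toM (p_sym im)) -{1}(sign_toM (d_sym im)).
by rewrite !mulrA.
Qed.

Lemma mirrorK i : involutive (mirror i).
Proof.
case=> x y; rewrite /mirror /= !mulrA.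
by rewrite -!expr2 !sign_toK !mul1r.
Qed.

Lemma folded_partial_sum (x : nat -> R[i]) (M : nat) :
  folded (\sum_(k < (M * N).+1) sqn (x k)) (\sum_(k < M * N) edge_sum_at x k).
Proof.
(* Period [t], here the sites from [t * N + 1] to [t.+1 * N], is read from both ends; [A] and [D]
   meet at [i = m]. Site [0] precedes all periods and is added to [U 0]. *)
pose A t i := x (t * N + i).+1.
pose D t i := x (t * N + (m.*2 - i)).+1.
pose U i := \sum_(t < M) (sqn (A t i) + sqn (D t i)) +
  (if i == 0%N then sqn (x 0%N) else 0).
(* On the descending half an edge runs from fold site [i.+1] to [i], so the conjugated factor is
   [D t i.+1]. *)
pose B i := \sum_(t < M) (A t i.+1 * (A t i)^* +
  mirror i (D t i * (D t i.+1)^*)).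
pose b := \sum_(t < M) 2 * Re (x (t * N).+1 * (x (t * N)%N)^*).
exists U, b, B; split.
- move=> i; rewrite addr_ge0 //; last by case: ifP => _ //; exact: sqn_ge0.
  by apply: sumr_ge0 => t _; apply: addr_ge0; exact: sqn_ge0.
- have Um : U m / 2 = \sum_(t < M) sqn (A t m).
    rewrite /U gtn_eqF // addr0 mulr_suml; apply: eq_bigr => t _.
    by rewrite /D (_ : m.*2 - m = m)%N ?/(A t m) -/(A t m); [lra | lia].
  have Ux : \sum_(i < m) (if i == 0%N :> nat then sqn (x 0%N) else 0) = sqn (x 0%N).
    by case: (m) m_gt0 => // m' _; rewrite big_ord_recl /= big1 ?addr0.
  rewrite /fold_weight Um /U big_split /= Ux exchange_big /=.
  rewrite big_ord_recl /= (sum_blocks (fun k => sqn (x k.+1))).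
  under [in RHS]eq_bigr => t _ do
    rewrite (sum_fold_mid (fun r => sqn (x (t * N + r).+1))).
  by rewrite [in RHS]big_split /= addrAC [LHS]addrC [X in _ + X]addrC.
(* Edge [t * N] joins the end of one period to the start of the next; the weight of site [0]
   supplies the left end of the first such edge. *)
- have Dx t : D t 0%N = x (t.+1 * N)%N by rewrite /D; congr x; lia.
  rewrite /b /U /A /= big_split /= -addrA.
  under [X in _ + (X + _)]eq_bigr => t _ do rewrite Dx.
  apply: (@le_trans _ _ (\sum_(t < M) (sqn (x (t * N).+1) + sqn (x (t * N)%N)))).
    apply: le_trans (ler_norm_sum _ _ _) _; apply: ler_sum => t _.
    exact: edge_amgm.
  under [X in X + _]eq_bigr => t _ do rewrite addn0.
  rewrite big_split /= lerD2l.
  have E : \sum_(t < M.+1) sqn (x (t * N)%N) =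
      sqn (x 0%N) + \sum_(t < M) sqn (x (t.+1 * N)%N) by rewrite big_ord_recl.
  by rewrite [leRHS]addrC -E big_ord_recr /= lerDl sqn_ge0.
- move=> i im; rewrite /B.
  (* Every single edge attains equality in the cone condition, which is stable under sums; the extra
     weight of site [0] only enlarges the bound. *)
  apply: (@le_trans _ _ ((\sum_(t < M) (sqn (A t i) + sqn (D t i))) *
      (\sum_(t < M) (sqn (A t i.+1) + sqn (D t i.+1))))).
    apply: cone_sum => t /=; try by apply: addr_ge0; exact: sqn_ge0.
    apply: cone_add; rewrite ?sqn_ge0 //.
      by rewrite sqnM sqnJ mulrC.
    by rewrite sqn_mirror sqnM sqnJ.
  rewrite /U /= addr0; apply: ler_wpM2r.
    by apply: sumr_ge0 => t _; apply: addr_ge0; exact: sqn_ge0.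
  by rewrite lerDl; case: ifP => // _; exact: sqn_ge0.
- rewrite sum_blocks /fold_value /b.
  under eq_bigr => t _ do
    rewrite (sum_fold_first (fun r => edge_sum_at x (t * N + r))).
  rewrite big_split /= exchange_big /=; congr (_ + _).
    rewrite mulr_sumr rmorph_sum; apply: eq_bigr => t _.
    rewrite /edge_sum_at edge_per d0 /edge /= mul0r addn0.
    by rewrite mulrA divfK.
  apply: eq_bigr => i _; rewrite edge_sum; apply: eq_bigr => t _.
  rewrite edgeD /edge_sum_at !edge_per edge_mirror //.
  rewrite /A /D; congr (_ + e _ (mirror _ _)).
    by rewrite addnS.
  by do 2?congr (_ * _); congr (x _)^*; case: i => i /= im; lia.
Qed.

Lemma folded_scale s z : 0 < s -> folded s z -> folded 1 (s^-1%:C * z).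
Proof.
move=> s0 [U [b [B [U0 Us bU BU ->]]]].
have s1 : 0 <= s^-1 by rewrite invr_ge0 ltW.
exists (fun i => s^-1 * U i), (s^-1 * b), (fun i => s^-1%:C * B i); split.
- by move=> i; rewrite mulr_ge0.
- rewrite /fold_weight -mulr_sumr -mulrA -mulrDr.
  by rewrite -[X in _ * X]/(fold_weight U) Us mulVf // gt_eqF.
- by rewrite normrM ger0_norm // ler_wpM2l.
- move=> i im; rewrite sqnM sqn_real expr2 mulrACA.
  by rewrite ler_wpM2l ?mulr_ge0 ?BU.
- rewrite /fold_value mulrDr -rmorphM mulrCA mulr_sumr; congr (_ + _).
  by apply: eq_bigr => i _; rewrite edgeZ.
Qed.

Definition extremal (z : R[i]) : Prop :=
  exists U s B, [/\ forall i, 0 <= U i, fold_weight U = 1, `|s| = 1,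
    forall i, (i < m)%N -> sqn (B i) = U i * U i.+1
    & z = fold_value (s * U 0%N) B].

Lemma fold_value_avg t b b' B B' :
  t%:C * fold_value b B + (1 - t)%:C * fold_value b' B' =
  fold_value (t * b + (1 - t) * b') (fun i => t%:C * B i + (1 - t)%:C * B' i).
Proof.
rewrite /fold_value !mulrDr -!rmorphM addrACA -rmorphD; congr (_%:C + _).
  by rewrite /GRing.scale /=; ring.
rewrite !mulr_sumr -big_split /=; apply: eq_bigr => i _.
by rewrite edgeD !edgeZ.
Qed.

Lemma segment_avg (r x : R) : `|x| <= r ->
  exists2 t, 0 <= t <= 1 & x = t * r + (1 - t) * - r.
Proof.
move=> xr; have r0 : 0 <= r := le_trans (normr_ge0 _) xr.
move: xr; rewrite ler_norml => /andP[xr1 xr2].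
have [r1|/eqP] := eqVneq r 0.
  by exists 1; rewrite ?lexx ?ler01 // r1 in xr1 xr2 *; lra.
move/eqP=> rN0; have {}r0 : 0 < r by rewrite lt_neqAle eq_sym rN0.
exists ((r + x) / (2 * r)); last by field.
rewrite divr_ge0 ?mulr_ge0 //= ?ler_pdivrMr ?mulr_gt0 //; [lra | lra | exact: ltW].
Qed.

(** For fixed [U] the value is real-affine in [(b, B)], so each parameter can be moved to the
    boundary of its interval or disk while the others stay put. *)
Lemma folded_sub_convex (K : R[i] -> Prop) :
  (forall t z w, 0 <= t <= 1 -> K z -> K w -> K (t%:C * z + (1 - t)%:C * w)) ->
  (forall z, extremal z -> K z) -> forall z, folded 1 z -> K z.
Proof.
move=> Kconv Kext _ [U [b [B [U0 U1 bU BU ->]]]].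
(* Only the first [k] products may still lie inside their disks; [b] is already at an endpoint. *)
suff main k : forall s B, (k <= m)%N -> `|s| = 1 ->
    (forall i, (i < k)%N -> sqn (B i) <= U i * U i.+1) ->
    (forall i, (k <= i < m)%N -> sqn (B i) = U i * U i.+1) ->
    K (fold_value (s * U 0%N) B).
  have [t t01 ->] := segment_avg bU.
  have BE : B = (fun i => t%:C * B i + (1 - t)%:C * B i).
    by apply/funext => i; rewrite -mulrDl -rmorphD addrC subrK mul1r.
  rewrite BE -fold_value_avg; apply: Kconv => //.
    rewrite -[U 0%N]mul1r; apply: (main m) => //; first by rewrite normr1.
    by move=> i; case: leqP.
  rewrite -mulN1r; apply: (main m) => //; first by rewrite normrN1.
  by move=> i; case: leqP.
elim: k => [|k IH] s B' km s1 Blt Bge.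
  by apply: Kext; exists U, s, B'; split=> // i im; exact: Bge.
have kB := Blt k (ltnSn k).
(* [B' k] lies between the boundary points of its disk on the same horizontal. *)
pose X := Num.sqrt (U k * U k.+1 - Im (B' k) ^+ 2).
have X2 : X ^+ 2 + Im (B' k) ^+ 2 = U k * U k.+1.
  by rewrite sqr_sqrtr ?subrK // subr_ge0 (le_trans _ kB) // lerDr sqr_ge0.
have /segment_avg[t t01 xE] : `|Re (B' k)| <= X.
  by rewrite -sqrtr_sqr ler_wsqrtr // lerBrDr.
pose Bs x i := if i == k then x +i* Im (B' k) else B' i.
have BE : B' = (fun i => t%:C * Bs X i + (1 - t)%:C * Bs (- X) i).
  apply/funext => i; rewrite /Bs; case: eqVneq => [->|_].
    by rewrite [LHS]complexE xE; apply: complex_ext => /=; ring.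
  by rewrite -mulrDl -rmorphD addrC subrK mul1r.
rewrite (_ : s * U 0%N = t * (s * U 0%N) + (1 - t) * (s * U 0%N)); last by ring.
rewrite BE -fold_value_avg; apply: Kconv => //; apply: IH => //; try exact: ltnW.
- by move=> i ik; rewrite /Bs ltn_eqF // Blt // ltnW.
- move=> i; rewrite /Bs; case: eqVneq => [-> _|ik kim]; first by rewrite /sqn /=.
  by apply: Bge; lia.
- by move=> i ik; rewrite /Bs ltn_eqF // Blt // ltnW.
- move=> i; rewrite /Bs; case: eqVneq => [-> _|ik kim].
    by rewrite /sqn /= sqrrN.
  by apply: Bge; lia.
Qed.

Lemma closed_le_fun (T : topologicalType) (f g : T -> R) :
  continuous f -> continuous g -> closed [set w | f w <= g w].
Proof.
move=> fc gc; rewrite (_ : [set w | _] = (g \- f) @^-1` [set y | 0 <= y]).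
  have [gf _] := continuous_closedP (g \- f).
  by apply: gf (@closed_ge R 0) => w; exact: cvgB (gc w) (fc w).
by apply/seteqP; split => w /=; rewrite subr_ge0.
Qed.

Lemma continuous_sum (T : topologicalType) (I : Type) (r : seq I)
    (f : I -> T -> R) : (forall i, continuous (f i)) ->
  continuous (fun w => \sum_(i <- r) f i w).
Proof. by move=> fc; apply: continuous_big => //; exact: add_continuous. Qed.

(* The parameters [(U, B, b)] of a folded value form a compact set; [b] is
   stored in the unused entry [Re (B m)]. *)
Lemma closed_folded : closed (folded 1 : set R[i]^o).
Proof.
pose V := 'rV[R]_m.+1.
pose T := (V * V * V)%type.
pose co (v : V) (k : nat) := v ord0 (inord k).
pose U (w : T) := co w.1.1.
pose X (w : T) := co w.1.2.
pose Y (w : T) := co w.2.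
have coc k : continuous (co ^~ k) by exact: coord_continuous.
have coc' (g : T -> V) k : continuous g -> continuous (fun w => co (g w) k).
  by move=> gc w; apply: (@continuous_comp _ _ _ g (co ^~ k)); [exact: gc|exact: coc].
have fst_c (S : T -> V * V) : continuous S -> continuous (fun w => (S w).1).
  by move=> Sc w; apply: (@continuous_comp _ _ _ S fst); [exact: Sc|exact: cvg_fst].
have snd_c (S : T -> V * V) : continuous S -> continuous (fun w => (S w).2).
  by move=> Sc w; apply: (@continuous_comp _ _ _ S snd); [exact: Sc|exact: cvg_snd].
have Uc k : continuous (U ^~ k) by apply: coc'; apply: fst_c => w; exact: cvg_fst.
have Xc k : continuous (X ^~ k) by apply: coc'; apply: snd_c => w; exact: cvg_fst.
have Yc k : continuous (Y ^~ k) by apply: coc' => w; exact: cvg_snd.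
(* The total weight [1] counts [U m] by half, so every [U i] is at most [2], and so are [|b|] and
   each [|B i|]. *)
pose box : set V := [set v | forall i, v ord0 i \in `[- 2, 2 : R]].
have box_compact : compact box.
  apply: (@rV_compact _ _ (fun=> `[- 2, 2 : R]%classic)).
  by move=> _; exact: segment_compact.
pose B w k : R[i] := X w k +i* Y w k.
pose K := [set w : T | [/\ forall i : 'I_m.+1, 0 <= U w i,
  fold_weight (U w) = 1, `|X w m| <= U w 0%N &
  forall i : 'I_m, sqn (B w i) <= U w i * U w i.+1]].
have K_closed : closed K.
  rewrite (_ : K = (\bigcap_(i : 'I_m.+1) [set w : T | 0 <= U w i]) `&`
      ([set w : T | fold_weight (U w) <= 1] `&` [set w : T | 1 <= fold_weight (U w)]) `&`
      [set w : T | `|X w m| <= U w 0%N] `&`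
      (\bigcap_(i : 'I_m) [set w : T | sqn (B w i) <= U w i * U w i.+1])); last first.
    apply/seteqP; split => w /=.
      move=> [U0 U1 XU BU]; split; last by move=> i _; exact: BU.
      by split => //; split; [move=> i _; exact: U0 | rewrite U1].
    move=> [[[U0 [U1 U1']] XU] BU]; split => //.
    - by move=> i; exact: U0.
    - by apply/eqP; rewrite eq_le U1.
    - by move=> i; exact: BU.
  have cstc (x : R) : continuous (cst x : T -> R) by move=> w; exact: cvg_cst.
  have Wc : continuous (fun w => fold_weight (U w)).
    move=> w; apply: cvgD; first by apply: continuous_sum => i; exact: Uc.
    by apply: cvgM; [exact: Uc | exact: cvg_cst].
  have K0 : closed (\bigcap_(i : 'I_m.+1) [set w : T | 0 <= U w i]).
    by apply: closed_bigI => i _; apply: closed_le_fun; [exact: cstc | exact: Uc].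
  have K1 : closed [set w : T | fold_weight (U w) <= 1].
    by apply: closed_le_fun; [exact: Wc | exact: cstc].
  have K2 : closed [set w : T | 1 <= fold_weight (U w)].
    by apply: closed_le_fun; [exact: cstc | exact: Wc].
  have K3 : closed [set w : T | `|X w m| <= U w 0%N].
    by apply: closed_le_fun; [move=> w; apply: cvg_norm; exact: Xc | exact: Uc].
  have K4 : closed (\bigcap_(i : 'I_m) [set w : T | sqn (B w i) <= U w i * U w i.+1]).
    apply: closed_bigI => i _; apply: closed_le_fun => w.
      by apply: cvgD; apply: cvgM; [exact: Xc|exact: Xc|exact: Yc|exact: Yc].
    by apply: cvgM; exact: Uc.
  by apply: closedI K4; apply: closedI K3; apply: closedI K0 _; exact: closedI.
have K_compact : compact ((box `*` box `*` box) `&` K).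
  apply: compact_closedI => //.
  by apply: compact_setX => //; exact: compact_setX.
pose f (w : T) : R[i]^o := fold_value (X w m) (B w).
have f_cont : continuous f.
  pose fR w := p 0%N / 2 * X w m + \sum_(i < m) p i.+1 * X w i.
  pose fI w := \sum_(i < m) d i.+1 * Y w i.
  have fE w : f w = fR w +i* fI w.
    rewrite /f /fold_value /fR /fI [RHS]complexE !rmorphD !rmorph_sum /= -addrA.
    congr (_ + _); rewrite mulr_sumr -big_split /=; apply: eq_bigr => i _.
    by rewrite [LHS]complexE.
  rewrite (_ : f = (fun w => fR w +i* fI w)); last exact/funext.
  have Mc k (g : T -> R) : continuous g -> continuous (fun w => k * g w).
    by move=> gc w; apply: cvgM; [exact: cvg_cst | exact: gc].
  move=> w; apply: cvg_Complex.
    by apply: cvgD; [exact: Mc | apply: continuous_sum => i; exact: Mc].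
  by apply: continuous_sum => i; exact: Mc.
rewrite (_ : folded 1 = f @` ((box `*` box `*` box) `&` K)).
  apply: compact_closed; first exact: norm_hausdorff.
  by apply: continuous_compact => //; exact: continuous_subspaceT.
have inordE (g : nat -> R) k : (k <= m)%N -> co (\row_j g j) k = g k.
  by move=> km; rewrite /co mxE inordK.
apply/seteqP; split.
  move=> z [U' [b [B' [U'0 U'1 bU BU ->]]]].
  pose B1 k := if k == m then b%:C else B' k.
  have U'2 k : (k <= m)%N -> U' k <= 2.
    have S0 : 0 <= \sum_(i < m) U' i by exact: sumr_ge0.
    rewrite leq_eqVlt => /orP[/eqP ->|km].
      by rewrite /fold_weight in U'1; lra.
    have := U'1; rewrite /fold_weight (bigD1 (Ordinal km)) //=.
    have : 0 <= \sum_(i < m | i != Ordinal km) U' i by exact: sumr_ge0.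
    have := U'0 m; lra.
  have B12 k : (k <= m)%N -> sqn (B1 k) <= 2 ^+ 2.
    rewrite /B1; case: eqVneq => [_ _|kN km].
      rewrite sqn_real -[leLHS]real_normK ?num_real // ler_pXn2r ?nnegrE //.
      exact: le_trans bU (U'2 0%N _).
    have {}km : (k < m)%N by rewrite ltn_neqAle kN.
    rewrite (le_trans (BU k km)) // expr2 ler_pM //; apply: U'2 => //.
    exact: ltnW.
  have abs2 (x y : R) : x ^+ 2 + y ^+ 2 <= 2 ^+ 2 -> (- 2 <= x <= 2) && (- 2 <= y <= 2).
    have H (t : R) : t ^+ 2 <= 2 ^+ 2 -> - 2 <= t <= 2.
      move=> t2; rewrite -ler_norml -(@ler_pXn2r _ 2) ?nnegrE //.
      by rewrite real_normK ?num_real.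
    by move=> xy; rewrite !H // (le_trans _ xy) ?lerDl ?lerDr ?sqr_ge0.
  have ReE k : (k <= m)%N -> co (\row_j Re (B1 j)) k = Re (B1 k).
    exact: (inordE (fun k => Re (B1 k))).
  have ImE k : (k <= m)%N -> co (\row_j Im (B1 j)) k = Im (B1 k).
    exact: (inordE (fun k => Im (B1 k))).
  exists (\row_j U' j, \row_j Re (B1 j), \row_j Im (B1 j)).
    split.
      split; [split|] => i /=; rewrite mxE in_itv /=.
      - by rewrite (le_trans _ (U'0 i)) ?oppr_le0 //= U'2 // -ltnS.
      - by have /abs2/andP[] := B12 i (ltn_ord i : (i <= m)%N).
      - by have /abs2/andP[] := B12 i (ltn_ord i : (i <= m)%N).
    split => [i||| i]; rewrite /B /U /X /Y /=.
    - by rewrite inordE // -ltnS.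
    - rewrite -[RHS]U'1 /fold_weight inordE //; congr (_ + _).
      by apply: eq_bigr => i _; rewrite inordE // ltnW.
    - by rewrite ReE // inordE // /B1 eqxx.
    - rewrite ReE ?ImE ?inordE //; try exact: ltnW.
      by rewrite /B1 ltn_eqF //; exact: BU.
  rewrite /f /fold_value /B /X /Y /= ReE // {1}/B1 eqxx.
  congr (_ + _); apply: eq_bigr => i _.
  rewrite ReE ?ImE; try exact: ltnW.
  by rewrite /B1 ltn_eqF.
move=> _ [w [_ [U0 U1 XU BU]] <-].
exists (U w), (X w m), (B w); split => //.
  (* [folded] asks for nonnegativity at every natural number; beyond [m], [inord] falls back to a
     valid index. *)
  by move=> i; have := U0 (inord i); rewrite /U /co inord_val.
by move=> i im; exact: (BU (Ordinal im)).
Qed.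

End Folding.

(** A path has no cycle to constrain the phases: [x k] gets modulus [sqrt (w k)] and the product of
    the phases of all earlier [E j]. *)
Lemma path_phases (R : realType) (w : nat -> R) (E : nat -> R[i]) :
  (forall k, 0 <= w k) -> (forall k, sqn (E k) = w k * w k.+1) ->
  exists x : nat -> R[i],
    (forall k, sqn (x k) = w k) /\ (forall k, x k.+1 * (x k)^* = E k).
Proof.
move=> w0 Ew.
(* If [E k] vanishes, so does [w k] or [w k.+1], and any phase will do. *)
pose phi k := if E k == 0 then 1 else (Num.sqrt (sqn (E k)))^-1%:C * E k.
have sqn_gt0 k : E k != 0 -> 0 < sqn (E k).
  by move=> Ek; rewrite -ltcR sqn_normC exprn_gt0 // normr_gt0.
have phi1 k : sqn (phi k) = 1.
  rewrite /phi; case: eqVneq => [_|Ek]; first by rewrite (sqn_real 1) expr1n.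
  rewrite sqnM sqn_real exprVn sqr_sqrtr ?sqn_ge0 // mulVf //.
  by rewrite gt_eqF // sqn_gt0.
pose u k := \prod_(j < k) phi j.
have u1 k : sqn (u k) = 1.
  elim: k => [|k IH]; first by rewrite /u big_ord0 (sqn_real 1) expr1n.
  by rewrite /u big_ord_recr /= sqnM IH phi1 mul1r.
exists (fun k => (Num.sqrt (w k))%:C * u k); split => k.
  by rewrite sqnM u1 mulr1 sqn_real sqr_sqrtr.
cbv beta; rewrite conjc_scale {1}/u big_ord_recr -/(u k) /=.
rewrite mulrACA [u k * _]mulrC -[phi k * _ * _]mulrA mul_conjC u1 mulr1.
rewrite -rmorphM -sqrtrM // [w k.+1 * _]mulrC -Ew /phi.
case: eqVneq => [->|Ek]; first by rewrite sqn0 sqrtr0 mul0r.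
by rewrite mulrA -rmorphM divff ?mul1r // sqrtr_eq0 -ltNge sqn_gt0.
Qed.

(** * Values at finitely supported vectors *)

Section FiniteVectors.
Variables (R : realType) (m : nat) (p d : nat -> R).
Local Notation N := (m.*2.+1).
Local Notation e k := (edge (p k) (d k)).
Hypothesis p_per : seq_periodic N p.
Hypothesis d_per : seq_periodic N d.

(** The squared norm [s] is left free so that convex combinations arise by scaling and adding. *)
Definition finite_value (s : R) (z : R[i]) : Prop :=
  exists x L, [/\ forall k, (L <= k)%N -> x k = 0,
    \sum_(k < L) sqn (x k) = s & z = \sum_(k < L) edge_sum_at p d x k].

Lemma finite_value_scale s t z : 0 <= t ->
  finite_value s z -> finite_value (t * s) (t%:C * z).
Proof.
move=> t0 [x [L [x0 <- ->]]].
exists (fun k => (Num.sqrt t)%:C * x k), L; split.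
- by move=> k Lk; rewrite x0 ?mulr0.
- rewrite mulr_sumr; apply: eq_bigr => k _.
  by rewrite sqnM sqn_real sqr_sqrtr.
- rewrite mulr_sumr; apply: eq_bigr => k _; rewrite /edge_sum_at -edgeZ.
  by rewrite conjc_scale mulrACA -rmorphM -expr2 sqr_sqrtr.
Qed.

Lemma sum_support (V : nmodType) (f : nat -> V) (L D : nat) : (L <= D)%N ->
  (forall k, (L <= k)%N -> f k = 0) -> \sum_(k < D) f k = \sum_(k < L) f k.
Proof.
move=> LD f0; rewrite -(subnKC LD) big_split_ord /= [X in _ + X]big1 ?addr0 //.
by move=> k _; rewrite f0 // leq_addr.
Qed.

(* Shifting the second vector by a multiple of the period, beyond the support
   of the first one, decouples the two quadratic forms. *)
Lemma finite_value_add s s' z z' : finite_value s z -> finite_value s' z' ->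
  finite_value (s + s') (z + z').
Proof.
move=> [x [L [x0 <- ->]]] [y [L' [y0 <- ->]]].
(* Since [L < D], site [D - 1] carries [0] and the edge joining the two vectors contributes
   nothing. *)
pose D := (L.+1 * N)%N.
have LD : (L < D)%N by rewrite /D mulnS leq_addr.
pose w k := if (k < D)%N then x k else y (k - D)%N.
have wl k : (k < D)%N -> w k = x k by rewrite /w => ->.
have wr k : w (D + k)%N = y k by rewrite /w ltnNge leq_addr /= addKn.
exists w, (D + L')%N; split.
- move=> k Dk; have kD : (D <= k)%N := leq_trans (leq_addr _ _) Dk.
  by rewrite -(subnKC kD) wr y0 // leq_subRL.
- rewrite big_split_ord /=; congr (_ + _); last first.
    by apply: eq_bigr => k _; rewrite wr.
  rewrite -(@sum_support _ (fun k => sqn (x k)) L D) ?(ltnW LD) //.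
    by apply: eq_bigr => k _; rewrite wl.
  by move=> k Lk; rewrite x0 ?sqn0.
- rewrite big_split_ord /=; congr (_ + _); last first.
    apply: eq_bigr => k _; rewrite /edge_sum_at -addnS !wr.
    by rewrite /D edge_per.
  rewrite -(@sum_support _ (edge_sum_at p d x) L D) ?(ltnW LD) //.
    apply: eq_bigr => k _; rewrite /edge_sum_at (wl k) //.
    have [kD|Dk] := ltnP k.+1 D; first by rewrite wl.
    by rewrite (x0 k) ?rmorph0 ?mulr0 // -ltnS (leq_trans LD).
  by move=> k Lk; rewrite /edge_sum_at (x0 k) // rmorph0 mulr0 edge0.
Qed.

(** Values scaled by [t] and [1 - t] add up to squared norm [1]; continuity of the average extends
    this to the closure. *)
Lemma closure_finite_avg (t : R) z w : 0 <= t <= 1 ->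
  closure (finite_value 1 : set R[i]^o) z ->
  closure (finite_value 1 : set R[i]^o) w ->
  closure (finite_value 1 : set R[i]^o) (t%:C * z + (1 - t)%:C * w).
Proof.
move=> /andP[t0 t1] cz cw B nB.
pose g (u : R[i]^o * R[i]^o) : R[i]^o := t%:C * u.1 + (1 - t)%:C * u.2.
have gc : continuous g.
  move=> u; apply: cvgD; apply: cvgM; try exact: cvg_cst.
    exact: cvg_fst.
  exact: cvg_snd.
have [[B1 B2] [/= nB1 nB2] sB] := gc (z, w) _ nB.
have [z' [fz Bz]] := cz _ nB1; have [w' [fw Bw]] := cw _ nB2.
exists (g (z', w')); split; last exact: sB.
rewrite /g /= (_ : finite_value 1 = finite_value (t * 1 + (1 - t) * 1)); last first.
  by congr finite_value; ring.
by apply: finite_value_add; apply: finite_value_scale; rewrite ?subr_ge0.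
Qed.

Hypothesis m_gt0 : (0 < m)%N.
Hypothesis d0 : d 0%N = 0.
Hypothesis p_sym : forall i, (i < m)%N -> `|p i.+1| = `|p (m.*2 - i)%N|.
Hypothesis d_sym : forall i, (i < m)%N -> `|d i.+1| = `|d (m.*2 - i)%N|.

(* The reflection of the edges sends site [k] to [1 - k] modulo the period: sites
   [0] and [1] are mirror images, and [m + 1] is fixed. *)
Definition fold_site (k : nat) : nat :=
  minn ((k + m.*2) %% N)%N (m.*2 - (k + m.*2) %% N)%N.

Lemma fold_site_first i t : (i <= m)%N -> fold_site (t * N + i.+1) = i.
Proof.
move=> im; rewrite /fold_site.
have -> : (t * N + i.+1 + m.*2 = t.+1 * N + i)%N by lia.
by rewrite modnMDl modn_small; lia.
Qed.

Lemma fold_site_last i t : (i <= m)%N -> fold_site (t * N + (m.*2 - i).+1) = i.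
Proof.
move=> im; rewrite /fold_site.
have -> : (t * N + (m.*2 - i).+1 + m.*2 = t.+1 * N + (m.*2 - i))%N by lia.
by rewrite modnMDl modn_small; lia.
Qed.

Lemma fold_site_per t : fold_site (t * N) = 0%N.
Proof. by rewrite /fold_site modnMDl modn_small; lia. Qed.

(** Read for edges: the self-mirrored edge of a period, the [m] edges after it, and their mirror
    images. *)
Lemma site_cases k : exists t,
  [\/ k = (t * N)%N, exists2 i, (i < m)%N & k = (t * N + i.+1)%N
    | exists2 i, (i < m)%N & k = (t * N + (m.*2 - i))%N].
Proof.
exists (k %/ N)%N; have := divn_eq k N; have := ltn_pmod k (ltn0Sn m.*2).
move: (k %% N)%N (k %/ N)%N => r t rN ->.
have [->|r0] := eqVneq r 0%N; first by constructor 1; rewrite addn0.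
have [rm|rm] := leqP r m.
  by constructor 2; exists r.-1; [lia | rewrite prednK // lt0n].
by constructor 3; exists (m.*2 - r)%N; [lia | congr (_ + _)%N; lia].
Qed.

(* The extremal value is approximated by truncating the periodic vector whose
   entries spread the fold weights evenly over the sites of each period. *)
Lemma extremal_finite z : extremal m p d z ->
  exists z', forall M, finite_value 1 (z - (M.+1%:R^-1)%:C * z').
Proof.
move=> [U [s [B [U0 U1 s1 BU zE]]]].
(* Two sites of each period lie over each [i < m] and one over [m], so a period weighs
   [fold_weight m U = 1]. *)
pose w k := U (fold_site k) / 2.
(* Each edge of a mirror pair receives half of the folded product; as [mirror] is an involution,
   both contribute equally. *)
pose E k := let r := (k %% N)%N in
  if r == 0%N then (s * U 0%N / 2)%:C
  else if (r <= m)%N then (2^-1)%:C * B r.-1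
  else (2^-1)%:C * mirror m p d (m.*2 - r) (B (m.*2 - r)%N).
have E0 t : E (t * N)%N = (s * U 0%N / 2)%:C by rewrite /E modnMl.
have E1 t i : (i < m)%N -> E (t * N + i.+1)%N = (2^-1)%:C * B i.
  by move=> im; rewrite /E modnMDl modn_small ?im //; lia.
have E2 t i : (i < m)%N ->
    E (t * N + (m.*2 - i))%N = (2^-1)%:C * mirror m p d i (B i).
  move=> im; rewrite /E modnMDl modn_small; last lia.
  rewrite ifF; last by lia.
  by rewrite ifF ?subKn //; lia.
have w0 k : 0 <= w k by rewrite divr_ge0.
have Ew k : sqn (E k) = w k * w k.+1.
  rewrite /w; have [t [->|[i im ->]|[i im ->]]] := site_cases k.
  - rewrite E0 fold_site_per -[(t * N).+1]addn1 (@fold_site_first 0) //.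
    have s2 : s ^+ 2 = 1 by rewrite -real_normK ?num_real // s1 expr1n.
    by rewrite sqn_real !exprMn s2; lra.
  - rewrite E1 // -addnS !fold_site_first ?(ltnW im) // sqnM sqn_real BU //; lra.
  - rewrite E2 // -addnS fold_site_last ?(ltnW im) //.
    rewrite (_ : (m.*2 - i)%N = (m.*2 - i.+1).+1); last lia.
    by rewrite fold_site_last // sqnM sqn_real sqn_mirror BU //; lra.
have [x [xw xE]] := path_phases w0 Ew.
have sum_w M : \sum_(k < M * N) w k = M%:R.
  rewrite sum_blocks -[M in RHS]card_ord -sum1_card natr_sum; apply: eq_bigr => t _.
  have wN i : (i < m)%N -> w (t * N + (m.*2 - i))%N = U i.+1 / 2.
    move=> im; rewrite /w (_ : (m.*2 - i)%N = (m.*2 - i.+1).+1); last lia.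
    by rewrite fold_site_last.
  rewrite (sum_fold_first (fun r => w (t * N + r)%N)) addn0.
  under eq_bigr => i _ do rewrite wN // /w fold_site_first ?(ltnW (ltn_ord i)) //.
  transitivity (fold_weight m U); last by rewrite U1.
  rewrite /w fold_site_per /fold_weight big_split /= -!mulr_suml.
  have : \sum_(i < m.+1) U i = U 0%N + \sum_(i < m) U i.+1 by rewrite big_ord_recl.
  by rewrite big_ord_recr /=; lra.
have sum_E M : \sum_(k < M * N) e k (E k) = M%:R%:C * z.
  rewrite (sum_blocks (fun k => e k (E k))).
  have -> : M%:R%:C * z = \sum_(t < M) z.
    by rewrite sumr_const card_ord rmorph_nat mulr_natl.
  apply: eq_bigr => t _.
  pose F k := edge (p k) (d k) (E k).
  rewrite (sum_fold_first (fun r => F (t * N + r)%N)) /F.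
  rewrite edge_per // addn0 E0 zE /fold_value; congr (_ + _).
    by rewrite /edge d0 mul0r /= mulrA mulrAC.
  apply: eq_bigr => i _; rewrite !edge_per // E1 // E2 // !edgeZ.
  rewrite (edge_mirror p_sym) // mirrorK -mulrDl -rmorphD.
  by rewrite [_ + _](_ : _ = 1) ?mul1r //; lra.
(* Truncation after [M.+1] periods cuts a single edge, a mirror image of edge [1], so the loss does
   not depend on [M]. *)
exists (e 1%N ((2^-1)%:C * B 0%N)) => M.
pose L := (M.+1 * N)%N.
have L_last : L = (M * N + (m.*2 - 0)).+1 by rewrite /L; lia.
pose y k := if (k < L)%N then x k else 0.
have y1 : finite_value M.+1%:R (M.+1%:R%:C * z - e 1%N ((2^-1)%:C * B 0%N)).
  exists y, L; split.
  - by move=> k Lk; rewrite /y ltnNge Lk.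
  - by rewrite -sum_w; apply: eq_bigr => k _; rewrite /y ltn_ord.
  - rewrite -sum_E -/L L_last !big_ord_recr /=.
    rewrite E2 // edge_per // !edgeZ (edge_mirror p_sym) // mirrorK.
    rewrite (_ : edge_sum_at p d y _ = 0); last first.
      by rewrite /edge_sum_at /y -L_last ltnn mul0r edge0.
    rewrite addr0 addrK; apply: eq_bigr => k _; rewrite /edge_sum_at /y -xE.
    by have := ltn_ord k; rewrite L_last => kL; rewrite !ifT // ltnW.
have := finite_value_scale (t := M.+1%:R^-1) _ y1.
rewrite mulVf ?pnatr_eq0 // mulrBr mulrA -rmorphM mulVf ?pnatr_eq0 // mul1r.
by apply; rewrite invr_ge0.
Qed.

Lemma extremal_closure z : extremal m p d z ->
  closure (finite_value 1 : set R[i]^o) z.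
Proof.
move=> /extremal_finite[z' fz].
apply: (@closure_cvg _ _ (fun M => z - (M.+1%:R^-1)%:C * z' : R[i]^o)).
  exact: nearW.
rewrite -[X in _ --> X]subr0; apply: cvgB; first exact: cvg_cst.
rewrite -[X in _ --> X](mul0r (z' : R[i]^o)); apply: cvgM; last exact: cvg_cst.
by apply: cvg_real_complex; exact: cvg_harmonic.
Qed.

End FiniteVectors.

(** * The quadratic form of the operator on square-summable sequences *)

Section TridiagonalOperator.
Variable R : realType.
Implicit Types (a c : nat -> R) (x : nat -> R[i]^o).

Local Notation T a c := (tridiag_op (fun j => (a j)%:C) (fun=> 0) (fun j => (c j)%:C)).
Local Notation p a c := (fun k => c k + a k.+1).
Local Notation d a c := (fun k => c k - a k.+1).

Lemma tridiag_op0 a c x : T a c x 0%N = (c 0%N)%:C * x 1%N.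
Proof.
by rewrite /tridiag_op !big_ord_recl big_ord0 /tridiag_entry /= mul0r add0r addr0.
Qed.

Lemma tridiag_opS a c x j :
  T a c x j.+1 = (c j.+1)%:C * x j.+2 + (a j.+1)%:C * x j.
Proof.
rewrite /tridiag_op !big_ord_recr /= big1 ?add0r => [|[k kj] _] /=; last first.
  by rewrite /tridiag_entry !ifF ?mul0r //; lia.
rewrite /tridiag_entry !eqxx !ifF; try lia.
by rewrite mul0r addr0 addrC.
Qed.

(** The rows up to [M] contain both halves of every edge [k < M], but only the superdiagonal half of
    edge [M]. *)
Lemma tridiag_partial_sum a c x M :
  \sum_(k < M.+1) T a c x k * (x k)^* =
  \sum_(k < M) edge_sum_at (p a c) (d a c) x k +
  (c M)%:C * (x M.+1 * (x M)^*).
Proof.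
elim: M => [|M IH].
  by rewrite big_ord_recr big_ord0 big_ord0 tridiag_op0 /= mulrA.
rewrite big_ord_recr /= IH [in RHS]big_ord_recr /= -!addrA; congr (_ + _).
rewrite /edge_sum_at -edgeE tridiag_opS -addrA; congr (_ + _).
by rewrite rmorphM /= conjCK mulrDl addrC [(_^* * x M)]mulrC !mulrA.
Qed.

Lemma finite_series_cvg (V : normedModType R[i]) (f : nat -> V) L :
  (forall k, (L <= k)%N -> f k = 0) -> series f @ \oo --> \sum_(k < L) f k.
Proof.
move=> f0; apply: cvg_near_cst; exists L => // n Ln.
by rewrite /series /= big_mkord; apply: sum_support.
Qed.

Lemma finite_value_l2 a c z : finite_value (p a c) (d a c) 1 z ->
  l2_numerical_range (T a c) z.
Proof.
move=> [x [L [x0 x1 zE]]].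
have nx : series (fun k => `|x k| ^+ 2 : R[i]^o) @ \oo --> (1 : R[i]^o).
  rewrite (_ : 1 = \sum_(k < L) (`|x k| ^+ 2 : R[i]^o)).
    by apply: finite_series_cvg => k Lk; rewrite x0 ?normr0 ?expr0n.
  by rewrite -[1]/(1%:C) -x1 rmorph_sum; apply: eq_bigr => k _; rewrite -sqn_normC.
exists x; first split.
- by apply: cvgP nx.
- rewrite /l2_dot; under eq_fun do rewrite -normCK.
  exact: cvg_lim nx.
- rewrite /l2_dot; apply: cvg_lim; first exact: norm_hausdorff.
  rewrite zE -[X in _ --> X]addr0.
  rewrite [X in _ --> _ + X](_ : 0 = (c L)%:C * (x L.+1 * (x L)^*)); last first.
    by rewrite x0 // mul0r mulr0.
  rewrite -tridiag_partial_sum.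
  by apply: finite_series_cvg => k Lk; rewrite (x0 k) ?rmorph0 ?mulr0 // ltnW.
Qed.

Lemma periodic_bounded (u : nat -> R) n : seq_periodic n.+1 u ->
  exists B, forall k, `|u k| <= B.
Proof.
move=> u_per; exists (\sum_(r < n.+1) `|u r|) => k.
have -> : u k = u (k %% n.+1)%N.
  rewrite {1}(divn_eq k n.+1); elim: (k %/ n.+1)%N => [//|t IH].
  by rewrite mulSn -addnA addnC u_per.
rewrite (bigD1 (Ordinal (ltn_pmod k (ltn0Sn n)))) //= lerDl.
exact: sumr_ge0.
Qed.

Lemma cvg_series_shift (f : nat -> R) :
  cvgn (series f) -> cvgn (series (fun k => f k.+1)).
Proof.
move=> cf; have -> : series (fun k => f k.+1) = (fun n => series f n.+1 - f 0%N).
  apply/funext => n; rewrite /series /= !big_mkord big_ord_recl /=.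
  by rewrite [f 0%N + _]addrC addrK.
apply: is_cvgB; last exact: is_cvg_cst.
by apply/cvg_ex; exists (limn (series f)); rewrite (cvg_shiftS (series f)).
Qed.

Lemma cvg_series_bounded (q v w : nat -> R) B :
  (forall k, `|q k| <= B) -> (forall k, `|v k| <= w k) -> cvgn (series w) ->
  cvgn (series (fun k => q k * v k)).
Proof.
move=> qB vw ws; apply: normed_cvg.
have B0 : 0 <= B := le_trans (normr_ge0 _) (qB 0%N).
have w0 k : 0 <= w k := le_trans (normr_ge0 _) (vw k).
apply: (@series_le_cvg _ _ (fun k => B * w k)) => [k|k|k|] //=.
- exact: mulr_ge0.
- by rewrite normrM ler_pM.
- exact: (@is_cvg_seriesZ _ _ B ws).
Qed.

(** Real and imaginary parts converge separately, each product being dominated by the weights of its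
    two sites. *)
Lemma series_edge_cvg (q e : nat -> R) B x :
  (forall k, `|q k| <= B) -> (forall k, `|e k| <= B) ->
  cvgn (series (fun k => sqn (x k))) ->
  cvgn (series (edge_sum_at q e x : nat -> R[i]^o)).
Proof.
move=> qB eB xs; pose w k := sqn (x k.+1) + sqn (x k).
have ws : cvgn (series w).
  exact: is_cvg_seriesD (cvg_series_shift xs) xs.
have half (r s : R) : `|2 * r| <= s -> `|r| <= s.
  by rewrite normrM ger0_norm //; have := normr_ge0 r; lra.
have Rew k : `|Re (x k.+1 * (x k)^*)| <= w k by apply/half/edge_amgm.
have Imw k : `|Im (x k.+1 * (x k)^*)| <= w k.
  (* Up to sign, the imaginary part is the real part after multiplication by [i], which leaves
     moduli unchanged. *)
  rewrite -normrN -ReiNIm mulrAC; apply/half.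
  apply: le_trans (edge_amgm _ _) _.
  by rewrite sqnM [sqn (_ +i* _)]/sqn /= expr0n expr1n add0r mulr1.
have /cvg_ex[u hu] := cvg_series_bounded qB Rew ws.
have /cvg_ex[v hv] := cvg_series_bounded eB Imw ws.
apply/cvg_ex; exists (u +i* v : R[i]^o).
have -> : series (edge_sum_at q e x : nat -> R[i]^o) = (fun n =>
    series (fun k => q k * Re (x k.+1 * (x k)^*)) n +i*
    series (fun k => e k * Im (x k.+1 * (x k)^*)) n).
  apply/funext; elim => [|n IH]; first by rewrite !seriesEnat /= !big_geq.
  by rewrite !seriesSr IH.
exact: cvg_Complex hu hv.
Qed.

(** Over whole periods the partial sums are folded values of weight tending to [1]; they are
    normalized, and closedness gives the limit. *)
Lemma l2_folded a c m z : (0 < m)%N ->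
  seq_periodic m.*2.+1 a -> seq_periodic m.*2.+1 c -> c 0%N = a 1%N ->
  (forall i, (i < m)%N -> `|p a c i.+1| = `|p a c (m.*2 - i)%N|) ->
  (forall i, (i < m)%N -> `|d a c i.+1| = `|d a c (m.*2 - i)%N|) ->
  l2_numerical_range (T a c) z -> folded m (p a c) (d a c) 1 z.
Proof.
move=> m0 aper cper c0a1 psym dsym [x [xl2 x1] <-].
have a1per : seq_periodic m.*2.+1 (fun k => a k.+1) by move=> k; rewrite -addSn aper.
have pper : seq_periodic m.*2.+1 (p a c) by move=> k; rewrite a1per cper.
have dper : seq_periodic m.*2.+1 (d a c) by move=> k; rewrite a1per cper.
have d0 : d a c 0%N = 0 by rewrite c0a1 subrr.
have S1 : series (fun k => sqn (x k)) @ \oo --> (1 : R).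
  have nx : series (fun k => `|x k| ^+ 2 : R[i]^o) @ \oo --> (1 : R[i]^o).
    by rewrite -x1 /l2_dot; under [in X in _ --> X]eq_fun do rewrite -normCK.
  have := cvg_comp _ _ nx (@Re_continuous R 1).
  rewrite (_ : _ \o _ = series (fun k => sqn (x k))) //.
  apply/funext => n; rewrite /series /= !big_mkord.
  by under eq_bigr do rewrite -sqn_normC; rewrite -rmorph_sum.
have Ss : cvgn (series (fun k => sqn (x k))) by apply: cvgP S1.
have Ecvg q e : seq_periodic m.*2.+1 q -> seq_periodic m.*2.+1 e ->
    cvgn (series (edge_sum_at q e x : nat -> R[i]^o)).
  move=> /periodic_bounded[B qB] /periodic_bounded[B' eB].
  apply: (@series_edge_cvg _ _ (Num.max B B')) => // k; rewrite le_max.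
    by rewrite qB.
  by rewrite eB orbT.
pose f : nat -> R[i]^o := edge_sum_at (p a c) (d a c) x.
have /cvg_ex[z' Ez] : cvgn (series f) := Ecvg _ _ pper dper.
(* The boundary term is an edge form with both coefficients [c], hence the general term of a
   convergent series. *)
have last0 : (fun k => (c k)%:C * (x k.+1 * (x k)^*) : R[i]^o) @ \oo --> (0 : R[i]^o).
  have := cvg_series_cvg_0 (Ecvg _ _ cper cper).
  suff -> : edge_sum_at c c x = (fun k => (c k)%:C * (x k.+1 * (x k)^*) : R[i]^o) by [].
  apply/funext => k; rewrite /edge_sum_at; case: (x k.+1 * _) => u v.
  by apply: complex_ext => /=; ring.
have -> : l2_dot (T a c x) x = z'.
  apply: cvg_lim; first exact: norm_hausdorff.
  rewrite -(cvg_shiftS (series _)) -[z']addr0.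
  rewrite (_ : (fun n => _) =
      (fun n => series f n + (c n)%:C * (x n.+1 * (x n)^*))).
    exact: cvgD Ez last0.
  by apply/funext => n; rewrite /series /= !big_mkord tridiag_partial_sum.
apply: closed_folded => //.
pose N := m.*2.+1.
have MN : (fun M => (M * N)%N) @ \oo --> \oo by exact: cvg_mulnr.
pose s M : R := \sum_(k < (M * N).+1) sqn (x k).
have s_cvg : s @ \oo --> (1 : R).
  move: S1; rewrite -(cvg_shiftS (series _)) => S1.
  rewrite (_ : s = (fun n => series (fun k => sqn (x k)) n.+1) \o (fun M => (M * N)%N)).
    exact: cvg_comp MN S1.
  by apply/funext => M; rewrite /s /series /= big_mkord.
apply: (@closure_cvg _ _ (fun M => (s M)^-1%:C * \sum_(k < M * N) f k : R[i]^o)).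
  have s_gt0 : \forall M \near \oo, 0 < s M by exact: (cvgr_gt _ s_cvg _ ltr01).
  apply: filterS s_gt0 => M sM.
  by apply: folded_scale sM _; exact: folded_partial_sum.
rewrite -[z']mul1r; apply: cvgM.
  apply: cvg_real_complex; rewrite -[X in _ --> X]invr1.
  by apply: cvgV => //; exact: oner_neq0.
rewrite (_ : (fun M => _) = series f \o (fun M => (M * N)%N)).
  exact: cvg_comp MN Ez.
by apply/funext => M; rewrite /series /= big_mkord.
Qed.

End TridiagonalOperator.

(** * Numerical ranges of the folded matrices *)

Lemma sum_tridiag (V : nmodType) (F : nat -> nat -> V) n :
  (forall i j, (i.+1 < j)%N || (j.+1 < i)%N -> F i j = 0) ->
  \sum_(i < n.+1) \sum_(j < n.+1) F i j =
  \sum_(i < n.+1) F i i + \sum_(i < n) (F i i.+1 + F i.+1 i).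
Proof.
move=> F0; elim: n => [|n IH]; first by rewrite !big_ord_recr !big_ord0 /= !add0r addr0.
rewrite big_ord_recr /=.
under eq_bigr => i _ do rewrite big_ord_recr /=.
rewrite big_split /= IH [in X in _ + _ + X + _]big_ord_recr /=.
rewrite [X in _ + _ + (X + _) + _]big1 ?add0r => [|i _]; last first.
  by rewrite F0 // ltnS ltn_ord.
rewrite [X in _ + X = _]big_ord_recr [X in _ + (X + _) = _]big_ord_recr /=.
rewrite [X in _ + (X + _ + _) = _]big1 ?add0r => [|i _]; last first.
  by rewrite F0 // orbC ltnS ltn_ord.
rewrite [in RHS]big_ord_recr [in X in _ = _ + X]big_ord_recr /=.
rewrite [F n.+1 n + _]addrC !addrA; congr (_ + _).
by rewrite -!addrA; congr (_ + _); rewrite addrA addrC.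
Qed.

Section FoldedMatrices.
Variables (R : realType) (m : nat) (a c : nat -> R).
Hypothesis m_gt0 : (0 < m)%N.
Hypothesis c0a1 : c 0%N = a 1%N.
Local Notation p := (fun k => c k + a k.+1).
Local Notation d := (fun k => c k - a k.+1).
Local Notation A s := (map_mx (real_complex R) (B_mx a c m s)).
Implicit Types (V : nat -> R[i]) (s : R).

(** Fold site [m] is counted twice, so [U m] is [2 |V m|^2] and the product on the last edge grows
    by [sqrt 2]. *)
Definition end_weight (i : nat) : R := if i.+1 == m then Num.sqrt 2 else 1.

Lemma cV_dotE n (x y : 'cV[R[i]]_n) :
  cV_dot x y = \sum_(i < n) x i 0 * (y i 0)^*.
Proof.
by rewrite /cV_dot dotmxE mxE; apply: eq_bigr => i _; rewrite !mxE.
Qed.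

Lemma cV_dot_self V :
  cV_dot (\col_(i < m.+1) V i) (\col_(i < m.+1) V i) = (\sum_(i < m.+1) sqn (V i))%:C.
Proof.
rewrite cV_dotE rmorph_sum; apply: eq_bigr => i _.
by rewrite mxE mul_conjC.
Qed.

(** The corner entry [s * a 1] is [s * p 0 / 2] because [c 0 = a 1]; the off-diagonal entries pair
    up into edges. *)
Lemma cV_dot_B_mx s V :
  cV_dot (A s *m \col_(i < m.+1) V i) (\col_(i < m.+1) V i) =
  fold_value m p d (s * sqn (V 0%N))
    (fun i => (end_weight i)%:C * (V i.+1 * (V i)^*)).
Proof.
pose b i j : R := if (i == 0%N) && (j == 0%N) then s * a 1%N
  else if j == i.+1 then end_weight i * c i.+1
  else if i == j.+1 then end_weight j * a i.+1 else 0.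
rewrite cV_dotE.
transitivity (\sum_(i < m.+1) \sum_(j < m.+1) (b i j)%:C * V j * (V i)^*).
  apply: eq_bigr => i _; rewrite !mxE mulr_suml; apply: eq_bigr => j _.
  rewrite !mxE /b /end_weight /= !eqSS; congr (_%:C * _ * _).
  do 3!case: ifP => //=; rewrite ?mul1r // => _ _ _.
  by case: ifP => _; rewrite ?mul1r.
rewrite (@sum_tridiag _ (fun i j => (b i j)%:C * V j * (V i)^*)); last first.
  move=> i j ij; rewrite /b !ifF ?rmorph0 ?mul0r //; lia.
rewrite big_ord_recl /= [X in _ + X + _]big1 ?addr0 => [|i _]; last first.
  by rewrite /b /= !ifF ?mul0r //; lia.
rewrite /fold_value; congr (_ + _).
  rewrite /b /= -mulrA mul_conjC -rmorphM; congr (_%:C).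
  by rewrite c0a1; field.
apply: eq_bigr => i _; rewrite edgeZ -edgeE.
rewrite /b !eqxx /= ifF; last by lia.
rewrite !ifF; try lia.
rewrite !rmorphM /= conjCK mulrDr !mulrA; congr (_ + _).
by rewrite -!mulrA; congr (_ * (_ * _)); rewrite mulrC.
Qed.

Lemma mx_range_extremal s z : `|s| = 1 ->
  mx_numerical_range (A s) z -> extremal m p d z.
Proof.
move=> s1 [v [_ v1] <-].
pose V k := v (inord k) 0.
have vE : v = \col_(i < m.+1) V i by apply/colP => i; rewrite mxE /V inord_val.
pose U i := if i == m then 2 * sqn (V i) else sqn (V i).
exists U, s, (fun i => (end_weight i)%:C * (V i.+1 * (V i)^*)); split => //.
- by move=> i; rewrite /U; case: ifP => _; rewrite ?mulr_ge0 ?sqn_ge0.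
- move: v1; rewrite {1 2}vE cV_dot_self => /complexI.
  rewrite big_ord_recr /= => <-; rewrite /fold_weight /U eqxx mulrC mulKf //.
  by congr (_ + _); apply: eq_bigr => i _; rewrite ltn_eqF.
- move=> i im; rewrite !sqnM sqnJ sqn_real /U /end_weight (ltn_eqF im).
  by case: eqVneq => _; rewrite ?sqr_sqrtr // ?expr1n; ring.
- by rewrite {1 2}vE cV_dot_B_mx /U ltn_eqF.
Qed.

(** Halving [U m] and dividing the last product by [sqrt 2] gives data from which [path_phases]
    builds a unit vector. *)
Lemma extremal_mx_range z : extremal m p d z ->
  mx_numerical_range (A 1) z \/ mx_numerical_range (A (- 1)) z.
Proof.
move=> [U [s [B [U0 U1 s1 BU ->]]]].
suff H : mx_numerical_range (A s) (fold_value m p d (s * U 0%N) B).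
  have : s ^+ 2 = 1 by rewrite -real_normK ?num_real // s1 expr1n.
  by move/eqP; rewrite sqrf_eq1 => /orP[]/eqP <-; [left | right].
(* The data are extended by [0] beyond [m], since [path_phases] concerns infinite paths. *)
pose w k := if (k < m)%N then U k else if k == m then U m / 2 else 0.
pose E k := if (k < m)%N then (end_weight k)^-1%:C * B k else 0.
have w0 k : 0 <= w k.
  by rewrite /w; case: ifP => // _; case: ifP => // _; rewrite divr_ge0.
have Ew k : sqn (E k) = w k * w k.+1.
  rewrite /E /w; case: ltnP => [km|mk]; last first.
    rewrite sqn0 [in X in _ * X]ifF; last by lia.
    by rewrite [in X in _ * X]ifF ?mulr0 //; lia.
  rewrite sqnM sqn_real BU // /end_weight exprVn.
  case: eqVneq => [kE|kN].
    by rewrite ifF ?kE ?ltnn // sqr_sqrtr // mulrC mulrA.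
  by rewrite expr1n invr1 mul1r ifT //; lia.
have [V [Vw VE]] := path_phases w0 Ew.
exists (\col_(i < m.+1) V i); first split=> //.
  rewrite cV_dot_self -[1]/(1%:C); congr (_%:C).
  rewrite -U1 big_ord_recr /= !Vw /w ltnn eqxx; congr (_ + _).
  by apply: eq_bigr => i _; rewrite Vw /w ltn_ord.
rewrite cV_dot_B_mx Vw /w m_gt0; rewrite /fold_value; congr (_ + _).
apply: eq_bigr => i _; congr edge; rewrite VE /E ltn_ord mulrA -rmorphM mulfV ?mul1r //.
by rewrite /end_weight; case: ifP; rewrite ?oner_eq0 // sqrtr_eq0 -ltNge.
Qed.

End FoldedMatrices.

(** * Convexity in terms of real weights *)

Section ComplexConvexity.
Variable R : realType.
Implicit Types K : set R[i]^o.

Lemma convex_set_avg K (t : R) (z w : R[i]) : convex_set K ->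
  0 <= t <= 1 -> K z -> K w -> K (t%:C * z + (1 - t)%:C * w).
Proof.
move=> Kconv /andP[t0 t1] Kz Kw.
have tC0 : 0 <= t%:C by rewrite lecR.
have tC1 : t%:C <= 1 by rewrite lecR.
have := Kconv z w (Itv01 tC0 tC1) (mem_set Kz) (mem_set Kw).
by rewrite inE /conv /= /unstable.onem rmorphB.
Qed.

Lemma avg_convex_set K :
  (forall (t : R) z w, 0 <= t <= 1 -> K z -> K w ->
     K (t%:C * z + (1 - t)%:C * w)) -> convex_set K.
Proof.
move=> Kavg z w l /set_mem Kz /set_mem Kw; apply/mem_set.
have [t tE] : exists t : R, l%:num = t%:C.
  by apply/complex_realP; rewrite ger0_real.
have t01 : 0 <= t <= 1.
  by rewrite -!lecR -tE ge0 /= le1.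
by have := Kavg t z w t01 Kz Kw; rewrite /conv /= /unstable.onem tE rmorphB.
Qed.

End ComplexConvexity.

Theorem corollary3p1 (R : realType) (n : nat) (hn : (0 < n)%N)
  (hodd : odd n.+1) (a c : nat -> R)
  (ha : seq_periodic n.+1 a) (hc : seq_periodic n.+1 c)
  (h0 : c 0%N = a 1%N)
  (h1p : `|c 1%N + a 2%N| = `|c n + a 0%N|)
  (h1m : `|c 1%N - a 2%N| = `|c n - a 0%N|)
  (hp : forall j : nat, (2 <= j <= n./2)%N ->
     `|c j + a j.+1| = `|c (n - j + 1)%N + a (n - j + 2)%N|)
  (hm : forall j : nat, (2 <= j <= n./2)%N ->
     `|c j - a j.+1| = `|c (n - j + 1)%N - a (n - j + 2)%N|) :
  closure (l2_numerical_range
    (tridiag_op (fun j => (a j)%:C) (fun=> 0) (fun j => (c j)%:C))) =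
  convex_hull
    (mx_numerical_range (map_mx (real_complex R) (B_mx a c n./2 1)) `|`
     mx_numerical_range (map_mx (real_complex R) (B_mx a c n./2 (- 1)))).
Proof.
set m := n./2; have nE : n = m.*2 by rewrite /m; lia.
have m_gt0 : (0 < m)%N by lia.
pose p k := c k + a k.+1; pose d k := c k - a k.+1.
have an : a n.+1 = a 0%N := ha 0%N.
have psym i : (i < m)%N -> `|p i.+1| = `|p (m.*2 - i)%N|.
  (* Edge [1] is mirrored to edge [n], whose subdiagonal entry [a n.+1] is [a 0] by periodicity. *)
  rewrite /p; case: i => [|i] im; first by rewrite subn0 -nE h1p an.
  rewrite hp; last by lia.
  by congr `|c _ + a _|; lia.
have dsym i : (i < m)%N -> `|d i.+1| = `|d (m.*2 - i)%N|.
  rewrite /d; case: i => [|i] im; first by rewrite subn0 -nE h1m an.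
  rewrite hm; last by lia.
  by congr `|c _ - a _|; lia.
rewrite nE in ha hc.
have aSper : seq_periodic m.*2.+1 (fun k => a k.+1) by move=> k; rewrite -addSn ha.
have pper : seq_periodic m.*2.+1 p by move=> k; rewrite /p aSper hc.
have dper : seq_periodic m.*2.+1 d by move=> k; rewrite /d aSper hc.
have d0 : d 0%N = 0 by rewrite /d h0 subrr.
apply/seteqP; split.
  (* The closed set [F] contains the range of the operator and lies in every convex set containing
     both matrix ranges. *)
  pose F : set R[i]^o := folded m p d 1.
  have /closure_id FE : closed F by exact: closed_folded.
  apply: (@subset_trans _ F).
    by rewrite FE; apply: closureS => z; exact: l2_folded.
  move=> z zf K [Kconv KB]; move: z zf; apply: folded_sub_convex => //.
    by move=> t z w; exact: convex_set_avg.
  by move=> z /(extremal_mx_range m_gt0 h0)[zB|zB]; apply: KB; [left | right].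
(* Conversely, this closure is convex and contains both matrix ranges, hence their hull. *)
apply: (@subset_trans _ (closure (finite_value p d 1 : set R[i]^o))).
  apply: smallest_sub; first by apply: avg_convex_set => t z w; exact: closure_finite_avg.
  move=> z zB; apply: extremal_closure => //.
  by case: zB; apply: mx_range_extremal => //; rewrite ?normrN normr1.
by apply: closureS => z; exact: finite_value_l2.
Qed.
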